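(* Let $G$ be a $k$-edge-connected $k$-regular graph. Then $k\leq \mathrm{srd}(G)\leq \chi'(G)$.
   Context: $\chi'(G)$ denotes the chromatic index of $G$ (minimum number of colors in a proper edge-coloring). An edge-coloring of $G$ is any map $c:E(G)\to[m]$ (adjacent edges may receive the same color). For distinct vertices $u,v$ of a connected graph $G$, a $u$-$v$-edge-cut is a set $F$ of edges such that $u$ and $v$ lie in different components of $G-F$; a minimum $u$-$v$-edge-cut is one of minimum size among these. A set of edges is rainbow if no two of its edges have the same color. An edge-colored connected graph is strong rainbow disconnected if for every two distinct vertices $u,v$ there is a $u$-$v$-edge-cut that is both rainbow and minimum; $\mathrm{srd}(G)$ is the smallest number of colors of an edge-coloring making $G$ strong rainbow disconnected. *)

(* Defs.v *)
From HB Require Import structures.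
From mathcomp Require Import all_boot.
Set Implicit Arguments.
Unset Strict Implicit.
Unset Printing Implicit Defensive.

Record sgraph := SGraph {
  vertex :> finType;
  adj : rel vertex;
  adj_sym : symmetric adj;
  adj_irrefl : irreflexive adj
}.

Definition edge_set (G : sgraph) : {set {set G}} :=
  [set [set p.1; p.2] | p in [set p : G * G | adj p.1 p.2]].

(* Edges form a type of their own, so that a colouring is a map on E(G) only;
   in particular an edgeless graph has a colouring with 0 colours. *)
Definition edge (G : sgraph) : finType := {e : {set G} | e \in edge_set G}.

Definition del_adj (G : sgraph) (F : {set edge G}) : rel G :=
  fun x y => adj x y && ([set x; y] \notin [set val e | e in F]).

Lemma del_adj_sym (G : sgraph) (F : {set edge G}) : symmetric (del_adj F).
Proof. by move=> x y; rewrite /del_adj adj_sym setUC. Qed.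

Lemma del_adj_irrefl (G : sgraph) (F : {set edge G}) : irreflexive (del_adj F).
Proof. by move=> x; rewrite /del_adj adj_irrefl. Qed.

Definition del_edges (G : sgraph) (F : {set edge G}) : sgraph :=
  SGraph (del_adj_sym F) (del_adj_irrefl F).

Definition connected (G : sgraph) : bool :=
  (0 < #|G|) && [forall x : G, forall y : G, connect (@adj G) x y].

Definition regular (k : nat) (G : sgraph) : bool :=
  [forall x : G, #|[set y : G | adj x y]| == k].

Definition edge_connected (k : nat) (G : sgraph) : bool :=
  [forall F : {set edge G}, (#|F| < k) ==> connected (del_edges F)].

Definition edge_cut (G : sgraph) (u v : G) (F : {set edge G}) : bool :=
  ~~ connect (@adj (del_edges F)) u v.

Definition min_edge_cut (G : sgraph) (u v : G) (F : {set edge G}) : bool :=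
  edge_cut u v F && [forall F' : {set edge G}, edge_cut u v F' ==> (#|F| <= #|F'|)].

Definition coloring (G : sgraph) (m : nat) := {ffun edge G -> 'I_m}.

Definition proper (G : sgraph) (m : nat) (c : coloring G m) : bool :=
  [forall e : edge G, forall f : edge G,
    (e != f) && (val e :&: val f != set0) ==> (c e != c f)].

Definition rainbow (G : sgraph) (m : nat) (c : coloring G m) (F : {set edge G}) : bool :=
  [forall e in F, forall f in F, (e != f) ==> (c e != c f)].

Definition strong_rainbow_disconnected (G : sgraph) (m : nat) (c : coloring G m) : bool :=
  [forall u : G, forall v : G, (u != v) ==>
    [exists F : {set edge G}, rainbow c F && min_edge_cut u v F]].

Definition enum_coloring (G : sgraph) : coloring G #|{: edge G}| :=
  [ffun e => enum_rank e].

Lemma proper_exists (G : sgraph) : exists m, [exists c : coloring G m, proper c].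
Proof.
exists #|{: edge G}|; apply/existsP; exists (enum_coloring G).
apply/forallP=> e; apply/forallP=> f; apply/implyP=> /andP[ef _].
by rewrite !ffunE (inj_eq enum_rank_inj).
Qed.

Lemma edge_cut_setT (G : sgraph) (u v : G) : u != v -> edge_cut u v [set: edge G].
Proof.
move=> uv; apply/negP=> /connectP[[|x p] /=]; first by move=> _ vu; rewrite vu eqxx in uv.
case/andP=> /andP[ux /negP nF] _ _; apply: nF.
have ein : [set u; x] \in edge_set G by apply/imsetP; exists (u, x); rewrite ?inE.
by apply/imsetP; exists (Sub [set u; x] ein : edge G); rewrite ?inE.
Qed.

Lemma srd_exists (G : sgraph) :
  exists m, [exists c : coloring G m, strong_rainbow_disconnected c].
Proof.
exists #|{: edge G}|; apply/existsP; exists (enum_coloring G).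
apply/forallP=> u; apply/forallP=> v; apply/implyP=> uv; apply/existsP.
case: (arg_minnP (fun F : {set edge G} => #|F|) (edge_cut_setT uv)) => F cF minF.
exists F; rewrite /min_edge_cut cF /=; apply/andP; split.
  apply/forall_inP=> e _; apply/forall_inP=> f _; apply/implyP=> ef.
  by rewrite !ffunE (inj_eq enum_rank_inj).
by apply/forallP=> F'; apply/implyP; apply: minF.
Qed.

Definition chromatic_index (G : sgraph) : nat := ex_minn (proper_exists G).

(* Only meaningful when G is connected. *)
Definition srd (G : sgraph) : nat := ex_minn (srd_exists G).

(* Main.v *)
(* Both bounds come from the minimum size of a cut being k: k-edge-connectedness
   bounds every cut from below, and the k edges at a vertex u form a cut
   separating u from everything else, which is rainbow when the colouring is
   proper. *)
Require Import Defs.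
From mathcomp Require Import all_boot.

Definition star (G : sgraph) (u : G) : {set edge G} := [set e : edge G | u \in val e].

(** A path from [u] to a different vertex has a first edge; it contains [u], hence was deleted. *)
Lemma edge_cut_star (G : sgraph) (u v : G) : u != v -> edge_cut u v (star G u).
Proof.
move=> uv; apply/negP=> /connectP[[|x p] /=]; first by move=> _ vu; rewrite vu eqxx in uv.
case/andP=> /andP[ux /negP nF] _ _; apply: nF.
have ein : [set u; x] \in edge_set G by apply/imsetP; exists (u, x); rewrite ?inE.
by apply/imsetP; exists (Sub [set u; x] ein : edge G); rewrite // inE set21.
Qed.

(** Each edge at [u] is [[set u; y]] for some neighbour [y], so the star lies in an image of the
    neighbourhood. *)
Lemma card_star_le (G : sgraph) (u : G) : #|star G u| <= #|[set y : G | adj u y]|.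
Proof.
rewrite -(card_imset _ (@val_inj _ _ (edge G))).
apply: leq_trans (leq_imset_card (fun y => [set u; y]) _).
apply: subset_leq_card; apply/subsetP=> _ /imsetP[[e ein] ue ->] /=.
move: ue; rewrite inE /=; case/imsetP: ein => -[x y]; rewrite inE /= => xy ->.
rewrite !inE => /orP[/eqP->|/eqP->]; apply/imsetP.
  by exists y; rewrite ?inE.
by exists x; rewrite ?inE 1?adj_sym // setUC.
Qed.

Lemma proper_rainbow_star (G : sgraph) (m : nat) (c : coloring G m) (u : G) :
  Defs.proper c -> rainbow c (star G u).
Proof.
move/forallP=> pc; apply/forall_inP=> e; rewrite inE => ue.
apply/forall_inP=> f; rewrite inE => uf; apply/implyP=> ef.
move/forallP/(_ f)/implyP: (pc e); apply; rewrite ef /=.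
by apply/set0Pn; exists u; rewrite inE ue.
Qed.

(** The colouring is injective on a rainbow set and takes values in ['I_m]. *)
Lemma rainbow_card (G : sgraph) (m : nat) (c : coloring G m) (F : {set edge G}) :
  rainbow c F -> #|F| <= m.
Proof.
move/forall_inP=> rF; rewrite -[m in _ <= m]card_ord -(@card_in_imset _ _ c).
  exact: max_card.
move=> e f eF fF cef; apply/eqP; apply: contraT => ef.
by move/forall_inP/(_ f fF)/implyP/(_ ef): (rF e eF); rewrite cef eqxx.
Qed.

Lemma edge_cut_card_ge (G : sgraph) (k : nat) (u v : G) (F : {set edge G}) :
  edge_connected k G -> edge_cut u v F -> k <= #|F|.
Proof.
move/forallP/(_ F)/implyP=> conF; apply: contraR; rewrite -ltnNge => /conF.
by case/andP=> _ /forallP/(_ u)/forallP/(_ v).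
Qed.

Lemma proper_strong_rainbow_disconnected (G : sgraph) (k m : nat)
  (c : coloring G m) :
  edge_connected k G -> regular k G -> Defs.proper c -> strong_rainbow_disconnected c.
Proof.
move=> Gec /forallP Greg pc.
apply/forallP=> u; apply/forallP=> v; apply/implyP=> uv.
apply/existsP; exists (star G u); rewrite proper_rainbow_star //=.
apply/andP; split; first exact: edge_cut_star.
apply/forallP=> F; apply/implyP=> cutF.
(* Compare through [k]: the star has at most [k] edges by regularity, the cut [F] at least [k]. *)
apply: leq_trans (edge_cut_card_ge _ _ _ _ _ Gec cutF).
by rewrite -(eqP (Greg u)) card_star_le.
Qed.

Lemma strong_rainbow_disconnected_ge (G : sgraph) (k m : nat)
  (c : coloring G m) :
  0 < #|G| -> edge_connected k G -> regular k G ->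
  strong_rainbow_disconnected c -> k <= m.
Proof.
case/card_gt0P=> u _ Gec /forallP/(_ u)/eqP Nu src.
(* For positive [k], regularity gives [u] a neighbour [v], and so a pair of distinct vertices that
   some rainbow cut separates. *)
have [->//|] := posnP k; rewrite -{1}Nu => /card_gt0P[v]; rewrite inE => uv.
have u'v : u != v by apply: contraTneq uv => ->; rewrite adj_irrefl.
move/forallP/(_ u)/forallP/(_ v)/implyP/(_ u'v)/existsP: src.
case=> F /andP[/rainbow_card rF /andP[cutF _]].
exact: leq_trans (edge_cut_card_ge _ _ _ _ _ Gec cutF) rF.
Qed.

Theorem theorem3p9 (G : sgraph) (k : nat)
  (Gconn : connected G) (Gec : edge_connected k G) (Greg : regular k G) :
  k <= srd G /\ srd G <= chromatic_index G.
Proof.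
rewrite /srd /chromatic_index; case: ex_minnP => m /existsP[c src] minm; split.
  by case/andP: Gconn => G0 _; apply: strong_rainbow_disconnected_ge src.
(* An optimal proper colouring [d] is itself strong rainbow disconnected, so minimality of [m]
   yields [m <= n]. *)
case: ex_minnP => n /existsP[d pd] _; apply: minm; apply/existsP; exists d.
exact: (proper_strong_rainbow_disconnected _ k).
Qed.
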